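(* Let $k>3$ be an integer and let $d=k^{2}-4$. Then the fundamental solution to the equation $x^{2}-dy^{2}=1$ is given by $$x_{1}+y_{1}\sqrt{d}=\begin{cases}\dfrac{k^{2}-2}{2}+\dfrac{k}{2}\sqrt{d} & \text{if } k \text{ is even},\\[2mm] \dfrac{k^{3}-3k}{2}+\dfrac{k^{2}-1}{2}\sqrt{d} & \text{if } k \text{ is odd}.\end{cases}$$
   Context: For a positive integer $d$ that is not a perfect square and a nonzero integer $N$, a pair $(a,b)$ of integers with $a^{2}-db^{2}=N$ is identified with $a+b\sqrt{d}$ and called a solution of $x^{2}-dy^{2}=N$; it is positive if $a>0$ and $b>0$. The fundamental solution of $x^{2}-dy^{2}=N$ is the positive solution $x_{1}+y_{1}\sqrt{d}$ such that $x_{1}+y_{1}\sqrt{d}<x_{2}+y_{2}\sqrt{d}$ for every other positive solution $x_{2}+y_{2}\sqrt{d}$ of the same equation. *)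

(* Defs.v *)
From Stdlib Require Import Reals ZArith.
Local Open Scope Z_scope.

Definition is_solution (d N : Z) (s : Z * Z) : Prop :=
  fst s ^ 2 - d * snd s ^ 2 = N.

Definition is_positive_solution (d N : Z) (s : Z * Z) : Prop :=
  is_solution d N s /\ 0 < fst s /\ 0 < snd s.

(* The real number a + b sqrt(d) with which (a, b) is identified; the
   identification is injective when d > 0 is not a perfect square. *)
Definition quad_val (d : Z) (s : Z * Z) : R :=
  (IZR (fst s) + IZR (snd s) * sqrt (IZR d))%R.

(* Meant for d > 0 not a perfect square and N <> 0. The comparison is strict
   against every other pair, so there is at most one such s. *)
Definition is_fundamental_solution (d N : Z) (s : Z * Z) : Prop :=
  is_positive_solution d N s /\
  forall t : Z * Z, is_positive_solution d N t -> t <> s ->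
    (quad_val d s < quad_val d t)%R.

(* Main.v *)
Require Import Defs.
From Stdlib Require Import Reals ZArith Lia.
Local Open Scope R_scope.

(** Put [e = (k + sqrt d) / 2].  Since [d = k ^ 2 - 4], [e] has norm 1 and the
    positive solutions of [X ^ 2 - d * Y ^ 2 = 4], read as
    [(X + Y * sqrt d) / 2], are exactly the powers of [e].  Solutions of
    [x ^ 2 - d * y ^ 2 = 1] are those with [X = 2 * x] and [Y = 2 * y] even:
    - [e] itself has [Y = 1], so it is never one of them;
    - [e ^ 2 = ((k ^ 2 - 2) + k * sqrt d) / 2] is one exactly when [k] is even;
    - [e ^ 3 = ((k ^ 3 - 3 * k) + (k ^ 2 - 1) * sqrt d) / 2] is one when [k] is
      odd.

    Only the first few powers matter, so the full classification is replaced by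
    division by [e]: a positive solution with [Y > 1] stays a positive solution
    when divided by [e] ([norm4_divide]).  As [e] is the least positive solution
    ([norm4_fst_ge]), being divisible once gives [Y >= k], and being divisible
    twice gives [Y >= k ^ 2 - 1] ([norm4_snd_ge_square], [norm4_snd_ge_cube]).
    A lower bound on [y] suffices for minimality because, among positive
    solutions, [x] increases with [y] ([fundamental_of_snd_minimal]). *)

Section NormFour.
Local Open Scope Z_scope.
Variable k : Z.
Hypothesis hk : 3 < k.

Lemma norm4_fst_ge (X Y : Z) :
  X ^ 2 - (k ^ 2 - 4) * Y ^ 2 = 4 -> 0 < X -> 0 < Y -> k <= X.
Proof.
intros E HX HY.
assert (1 <= Y ^ 2) by nia.
assert (k ^ 2 <= X ^ 2) by nia.
nia.
Qed.

(** The pair [(X', Y')] is the quotient by [e], that is the product with the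
    conjugate [(k - sqrt d) / 2].  It is integral because the equation reads
    [X ^ 2 - (k * Y) ^ 2 = 4 - 4 * Y ^ 2], which makes [X] and [k * Y] congruent
    modulo 2, and it has [Y' > 0] because the right-hand side is negative for
    [Y > 1].  Then [X' > 0] as well: since [|X'| > Y' * sqrt d] and [k > sqrt d],
    a negative [X'] would make [2 * X = k * X' + d * Y'] negative. *)
Lemma norm4_divide (X Y : Z) :
  X ^ 2 - (k ^ 2 - 4) * Y ^ 2 = 4 -> 0 < X -> 1 < Y ->
  exists X' Y' : Z,
    X' ^ 2 - (k ^ 2 - 4) * Y' ^ 2 = 4 /\ 0 < X' /\ 0 < Y' /\
    2 * X = k * X' + (k ^ 2 - 4) * Y' /\ 2 * Y = k * Y' + X'.
Proof.
intros E HX HY.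
assert (Hpar : exists Y', k * Y - X = 2 * Y').
{ destruct (Z.Even_or_Odd (k * Y - X)) as [[c Hc] | [c Hc]].
  - now exists c.
  - exfalso.
    assert (X = k * Y - 2 * c - 1) by lia; subst X.
    assert (2 * (2 * (1 - Y ^ 2 + k * Y * c - c ^ 2 - c) + k * Y) = 1) by nia.
    lia. }
destruct Hpar as [Y' HY'].
assert (HX' : X = k * Y - 2 * Y') by lia.
assert (Hlt : X < k * Y) by nia.
assert (E' : 1 - Y ^ 2 + k * Y * Y' - Y' ^ 2 = 0) by (subst X; nia).
exists (2 * Y - k * Y'), Y'.
assert (0 < Y') by lia.
repeat split; subst X; nia.
Qed.

(** [Y > 1] rules out [e], so the quotient by [e] is again a power of [e] with
    positive exponent; multiplying the bounds on it by [e] reaches [e ^ 2]. *)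
Lemma norm4_snd_ge_square (X Y : Z) :
  X ^ 2 - (k ^ 2 - 4) * Y ^ 2 = 4 -> 0 < X -> 1 < Y -> k <= Y.
Proof.
intros E HX HY.
destruct (norm4_divide X Y E HX HY) as (X' & Y' & E' & PX & PY & _ & HY2).
pose proof (norm4_fst_ge X' Y' E' PX PY).
nia.
Qed.

(** [Y <> k] rules out [e ^ 2], so the quotient by [e] is not [e] and can be
    divided once more; multiplying back twice reaches [e ^ 3]. *)
Lemma norm4_snd_ge_cube (X Y : Z) :
  X ^ 2 - (k ^ 2 - 4) * Y ^ 2 = 4 -> 0 < X -> 1 < Y -> Y <> k ->
  k ^ 2 - 1 <= Y.
Proof.
intros E HX HY Hne.
destruct (norm4_divide X Y E HX HY) as (X' & Y' & E' & PX & PY & _ & HY2).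
destruct (Z.eq_dec Y' 1) as [-> | HY'].
- assert (X' = k) by nia. lia.
- destruct (norm4_divide X' Y' E' PX) as (X2 & Y2 & E2 & PX2 & PY2 & HX3 & HY3);
    [lia |].
  pose proof (norm4_fst_ge X2 Y2 E2 PX2 PY2).
  assert (k <= Y') by nia.
  assert (k ^ 2 - 2 <= X') by nia.
  nia.
Qed.

End NormFour.

(** On positive solutions with [d > 0], [x ^ 2 = N + d * y ^ 2] makes [x] a
    strictly increasing function of [y], so comparing values of
    [x + y * sqrt d] amounts to comparing [y]. *)
Lemma fundamental_of_snd_minimal (d N x1 y1 : Z) :
  (0 < d)%Z -> is_positive_solution d N (x1, y1) ->
  (forall x y, is_positive_solution d N (x, y) -> (y1 <= y)%Z) ->
  is_fundamental_solution d N (x1, y1).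
Proof.
intros Hd Hs Hmin; split; [exact Hs |].
intros [x y] Ht Hne.
pose proof (Hmin x y Ht) as Hy.
unfold is_positive_solution, is_solution in Hs, Ht; cbn [fst snd] in *.
destruct Hs as (E1 & Px1 & Py1), Ht as (E & Px & Py).
assert (Hlt : (y1 < y)%Z).
{ destruct (Z.eq_dec y y1) as [-> |]; [| lia].
  exfalso; apply Hne; f_equal; nia. }
assert (Hx : (x1 < x)%Z).
{ assert (y1 ^ 2 < y ^ 2)%Z by nia.
  assert (x1 ^ 2 < x ^ 2)%Z by nia.
  nia. }
unfold quad_val; simpl.
apply Rplus_lt_compat.
- now apply IZR_lt.
- apply Rmult_lt_compat_r; [apply sqrt_lt_R0 |]; now apply IZR_lt.
Qed.

Theorem corollary3 (k d : Z) (hk : (3 < k)%Z) (hd : d = (k ^ 2 - 4)%Z) :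
  exists x1 y1 : Z,
    is_fundamental_solution d 1 (x1, y1) /\
    IZR x1 + IZR y1 * sqrt (IZR d) =
      if Z.even k
      then (IZR k ^ 2 - 2) / 2 + IZR k / 2 * sqrt (IZR d)
      else (IZR k ^ 3 - 3 * IZR k) / 2 + (IZR k ^ 2 - 1) / 2 * sqrt (IZR d).
Proof.
assert (Hd : (0 < d)%Z) by nia.
destruct (Z.even k) eqn:Hpar.
- apply Z.even_spec in Hpar; destruct Hpar as [m Hm].
  exists (2 * m ^ 2 - 1)%Z, m; split.
  + apply fundamental_of_snd_minimal; [exact Hd | |].
    * unfold is_positive_solution, is_solution; cbn [fst snd].
      subst d k; repeat split; [ring | nia | nia].
    * intros x y (E & Px & Py); unfold is_solution in E.
      cbn [fst snd] in *.
      assert (k <= 2 * y)%Z by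
        (apply (norm4_snd_ge_square k hk (2 * x)); subst d; lia).
      lia.
  + generalize (sqrt (IZR d)); intro r.
    subst k; replace (m ^ 2)%Z with (m * m)%Z by ring.
    rewrite minus_IZR, ?mult_IZR; field.
- assert (Hodd : Z.odd k = true) by now rewrite <- Z.negb_even, Hpar.
  apply Z.odd_spec in Hodd; destruct Hodd as [m Hm].
  exists ((2 * m + 1) * (2 * m ^ 2 + 2 * m - 1))%Z, (2 * m ^ 2 + 2 * m)%Z; split.
  + apply fundamental_of_snd_minimal; [exact Hd | |].
    * unfold is_positive_solution, is_solution; cbn [fst snd].
      subst d k; repeat split; [ring | nia | nia].
    * intros x y (E & Px & Py); unfold is_solution in E.
      cbn [fst snd] in *.
      (* The square of the unit is excluded by parity: 2 * y cannot equal k. *)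
      assert (k ^ 2 - 1 <= 2 * y)%Z by
        (apply (norm4_snd_ge_cube k hk (2 * x)); subst d; lia).
      subst k; lia.
  + generalize (sqrt (IZR d)); intro r.
    subst k; replace (m ^ 2)%Z with (m * m)%Z by ring.
    repeat rewrite ?mult_IZR, ?minus_IZR, ?plus_IZR; field.
Qed.
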